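(* Let $f$ be the map on nonnegative integers given by $f(n)=\lfloor n/\sqrt{2}\rfloor$ if $n$ is even and $f(n)=\lfloor n\sqrt{2}\rfloor$ if $n$ is odd. Let $m$ be a positive integer. Then: (i) $m$ has no predecessor under $f$ if and only if $m=\lfloor n(2+\sqrt{2})\rfloor$ for some integer $n\ge 1$; (ii) $m$ has exactly one predecessor under $f$ if and only if $m=\lfloor 2k\sqrt{2}\rfloor$ for some integer $k\ge 1$; (iii) $m$ has exactly two predecessors under $f$ if and only if $m=\lfloor (2k-1)\sqrt{2}\rfloor$ for some integer $k\ge 1$.
   Context: A predecessor of $m$ under $f$ is a nonnegative integer $n$ with $f(n)=m$. Here $\lfloor\cdot\rfloor$ denotes the integer part (floor). *)

(* Defs.v *)
From mathcomp Require Import all_boot all_order all_algebra.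
From mathcomp Require Import all_classical all_reals.
Set Implicit Arguments.
Unset Strict Implicit.
Unset Printing Implicit Defensive.
Import Order.TTheory GRing.Theory Num.Theory.
Local Open Scope classical_set_scope.
Local Open Scope ring_scope.

(* [Num.truncn x : nat] is the integer part of [x] for [0 <= x]; it is only
   ever applied to nonnegative reals here. *)
Definition sqrt2_map (R : realType) (n : nat) : nat :=
  if odd n then Num.truncn (n%:R * Num.sqrt 2 : R)
  else Num.truncn (n%:R / Num.sqrt 2 : R).

Definition predecessors (f : nat -> nat) (m : nat) : set nat :=
  [set n | f n = m].

(* Main.v *)
Require Import Defs.
From mathcomp Require Import all_boot all_order all_algebra.
From mathcomp Require Import all_classical all_reals.
From mathcomp Require Import zify ring lra.
Import Order.TTheory GRing.Theory Num.Theory.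
Local Open Scope classical_set_scope.
Local Open Scope ring_scope.

(** Write [B k] for the integer part of [k * sqrt 2]. Since [2j / sqrt 2 =
    j * sqrt 2], the map sends [2j] to [B j], and an odd [n] to [B n]. As [B] is
    injective, [m] has no predecessor if [m] is not a value of [B], the only
    predecessor [2k] if [m = B k] with [k] even, and exactly the two
    predecessors [k] and [2k] if [m = B k] with [k] odd. The values missed by
    [B] are identified by Beatty's theorem, because
    [1 / sqrt 2 + 1 / (2 + sqrt 2) = 1]. *)

Definition floor_mul_sqrt2 (R : realType) (k : nat) : nat :=
  Num.truncn (k%:R * Num.sqrt 2 : R).

Lemma sqr_sqrt2 (R : realType) : Num.sqrt 2 * Num.sqrt 2 = 2 :> R.
Proof. by rewrite -expr2 sqr_sqrtr. Qed.

Lemma sqrt2_bounds (R : realType) : 1 < Num.sqrt 2 :> R /\ Num.sqrt 2 < 2 :> R.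
Proof.
have := sqr_sqrt2 R; have : 0 <= Num.sqrt 2 :> R by exact: sqrtr_ge0.
by move: (Num.sqrt 2 : R) => r r0 r2; split; nra.
Qed.

(** The exponent of 2 is odd on the left and even on the right. *)
Lemma double_square_neq_square (q m : nat) :
  (0 < m)%N -> (2 * (q * q) <> m * m)%N.
Proof.
move=> m0 e; have q0 : (0 < q)%N by case: q e m0 => //; case: m.
move: (congr1 (logn 2) e); rewrite !lognM ?muln_gt0 ?q0 ?m0// logn_prime//=.
lia.
Qed.

Lemma mul_sqrt2_neq_nat (R : realType) (q m : nat) :
  (0 < m)%N -> q%:R * Num.sqrt 2 <> m%:R :> R.
Proof.
move=> m0 e; apply: (@double_square_neq_square q m) => //; apply/eqP.
rewrite -(eqr_nat R) !natrM -e; apply/eqP.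
by have := sqr_sqrt2 R; move: (Num.sqrt 2 : R) => r r2; ring: r2.
Qed.

Lemma floor_mul_sqrt2P (R : realType) (k m : nat) :
  floor_mul_sqrt2 R k = m <->
  m%:R <= k%:R * Num.sqrt 2 :> R /\ k%:R * Num.sqrt 2 < m%:R + 1 :> R.
Proof.
have h : 0 <= k%:R * Num.sqrt 2 :> R by rewrite mulr_ge0 ?sqrtr_ge0.
rewrite natr1; split => [<-|[h1 h2]]; first by case/andP: (truncn_itv h).
by apply: truncn_def; rewrite h1.
Qed.

(** As [sqrt 2 > 1], multiples of [sqrt 2] with distinct indices are more than 1 apart, so no unit
    interval contains two of them. *)
Lemma floor_mul_sqrt2_inj (R : realType) : injective (floor_mul_sqrt2 R).
Proof.
have lt_neq j k : (j < k)%N -> floor_mul_sqrt2 R j <> floor_mul_sqrt2 R k.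
  move=> jk /floor_mul_sqrt2P [+ _].
  have /floor_mul_sqrt2P [_ h] := erefl (floor_mul_sqrt2 R k).
  move: jk h; rewrite -(ler_nat R) -(natr1 j).
  by have [] := sqrt2_bounds R; nra.
move=> j k e; case: (ltngtP j k) => // /lt_neq; first by [].
by rewrite e.
Qed.

(* [n] and the number [q] of positive [k] with [k * sqrt 2 < m] are linked by
   [n + q = m]; then [m <= n * (2 + sqrt 2)] is [q * sqrt 2 <= m] multiplied by
   [1 + sqrt 2], and [n * (2 + sqrt 2) < m + 1] is likewise
   [m + 1 < (q + 1) * sqrt 2]. *)
Lemma beatty_sqrt2 (R : realType) (m : nat) : (0 < m)%N ->
  (forall k, floor_mul_sqrt2 R k <> m) <->
  (exists n : nat, (1 <= n)%N /\ m = Num.truncn (n%:R * (2 + Num.sqrt 2) : R)).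
Proof.
move=> m0; have [r1 r2] := sqrt2_bounds R; have rr := sqr_sqrt2 R.
have irr q := @mul_sqrt2_neq_nat R q m m0.
have irrS q := @mul_sqrt2_neq_nat R q m.+1 isT.
split=> [noB|[n [n1 /esym mE]] k /floor_mul_sqrt2P [k1 k2]].
(* Take [q] largest with [q * sqrt 2 < m + 1], equality being excluded by irrationality. Since [m]
   is not the integer part of [q * sqrt 2], even [q * sqrt 2 < m] holds. *)
- have m0R : 0 <= m.+1%:R / Num.sqrt 2 :> R by rewrite divr_ge0 ?sqrtr_ge0.
  have r0 : 0 < Num.sqrt 2 :> R by lra.
  have /andP[] := truncn_itv m0R; set q := Num.truncn _.
  rewrite ler_pdivlMr// ltr_pdivrMr// => q1 q2.
  have {}q1 : q%:R * Num.sqrt 2 < m.+1%:R :> R by rewrite lt_neqAle q1 andbT; apply/eqP.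
  have q3 : q%:R * Num.sqrt 2 < m%:R :> R.
    rewrite ltNge; apply/negP => h; apply: (noB q); apply/floor_mul_sqrt2P.
    by rewrite natr1.
  have qm : (q < m)%N.
    rewrite -(ltr_nat R); apply: le_lt_trans q3.
    by rewrite ler_peMr// ltW.
  exists (m - q)%N; rewrite subn_gt0; split=> //; apply/esym/truncn_def.
  rewrite natrB ?(ltnW qm)//; move: q1 q2 q3; rewrite -(natr1 m) -(natr1 q).
  move: (Num.sqrt 2 : R) (m%:R : R) (q%:R : R) r1 r2 rr => r M Q r1 r2 rr h1 h2 h3.
  have Qrr : Q * r * r = 2 * Q by rewrite -mulrA rr mulrC.
  have r10 : 0 < 1 + r by lra.
  apply/andP; split.
    by have : Q * r * (1 + r) < M * (1 + r); [rewrite ltr_pM2r | lra].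
  by have : (M + 1) * (1 + r) < (Q + 1) * r * (1 + r); [rewrite ltr_pM2r | lra].
(* Conversely, put [q = m - n]. The bounds on [n * (2 + sqrt 2)] give [q * sqrt 2 < m] and
   [m + 1 < (q + 1) * sqrt 2], so a [k] with [m <= k * sqrt 2 < m + 1] would lie strictly between
   [q] and [q + 1]. *)
- have n0 : 0 <= n%:R * (2 + Num.sqrt 2) :> R by rewrite mulr_ge0// addr_ge0 ?sqrtr_ge0.
  have /andP[] := truncn_itv n0; rewrite mE -(natr1 m) => b1 b2.
  have n1R : 1 <= n%:R :> R by rewrite (ler_nat R 1).
  have nm : (n < m)%N by rewrite -(ltr_nat R); nra.
  have := irr (m - n)%N; rewrite natrB ?(ltnW nm)// => /eqP qne.
  have qlt : (m%:R - n%:R) * Num.sqrt 2 < m%:R :> R.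
    by rewrite lt_neqAle qne /=; nra.
  have qk : (m - n < k)%N.
    rewrite -(ltr_nat R) natrB ?(ltnW nm)//; nra.
  move: qk; rewrite -(ler_nat R) -(natr1 (m - n)) natrB ?(ltnW nm)//; nra.
Qed.

Lemma sqrt2_map_double (R : realType) (j : nat) :
  sqrt2_map R j.*2 = floor_mul_sqrt2 R j.
Proof.
rewrite /sqrt2_map odd_double /floor_mul_sqrt2; congr Num.truncn.
have [r1 _] := sqrt2_bounds R; have rr := sqr_sqrt2 R.
rewrite -muln2 natrM -{1}rr mulrA mulfK// gt_eqF//; lra.
Qed.

Lemma predecessorsE (R : realType) (m : nat) :
  predecessors (sqrt2_map R) m =
  [set k.*2 | k in [set k | floor_mul_sqrt2 R k = m]] `|`
  [set k | odd k /\ floor_mul_sqrt2 R k = m].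
Proof.
apply/seteqP; split=> n /=.
- rewrite /predecessors /=; have [nodd|neven] := boolP (odd n).
    by rewrite /sqrt2_map nodd; right.
  rewrite -(even_halfK neven) sqrt2_map_double => e.
  by left; exists n./2.
- case=> [[k e <-]|[o e]]; rewrite /predecessors /= ?sqrt2_map_double//.
  by rewrite /sqrt2_map o.
Qed.

Lemma predecessors_nonvalue (R : realType) (m : nat) :
  (forall k, floor_mul_sqrt2 R k <> m) -> predecessors (sqrt2_map R) m = set0.
Proof.
move=> h; rewrite predecessorsE; apply/seteqP; split=> // n /=.
by case=> [[k /h]|[_ /h]].
Qed.

Lemma predecessors_even_value (R : realType) (k : nat) : ~~ odd k ->
  predecessors (sqrt2_map R) (floor_mul_sqrt2 R k) = [set k.*2].
Proof.
move=> ek; rewrite predecessorsE; apply/seteqP; split=> n /=.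
- case=> [[j /floor_mul_sqrt2_inj -> ->//]|[+ /floor_mul_sqrt2_inj nk]].
  by rewrite nk (negbTE ek).
- by move=> ->; left; exists k.
Qed.

Lemma predecessors_odd_value (R : realType) (k : nat) : odd k ->
  predecessors (sqrt2_map R) (floor_mul_sqrt2 R k) = [set k.*2; k].
Proof.
move=> ok; rewrite predecessorsE; apply/seteqP; split=> n /=.
- by case=> [[j /floor_mul_sqrt2_inj -> ->]|[_ /floor_mul_sqrt2_inj]]; [left|right].
- by case=> ->; [left; exists k|right].
Qed.

(** This lets the number of predecessors determine the parity of [k] when [m = B k]. *)
Lemma card_eq_I_unique (T : Type) (A : set T) (i j : nat) :
  (A #= `I_i)%card -> (A #= `I_j)%card -> i = j.
Proof.
by move=> Ai Aj; apply/card_eq_II; apply: card_eq_trans Aj; rewrite card_eq_sym.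
Qed.

Lemma card_set2 (T : Type) (x y : T) : x <> y -> ([set x; y] #= `I_2)%card.
Proof.
move=> xy; apply/eq_cardSP; exists x; first by left.
suff -> : [set x; y] `\ x = [set y] by exact: card_set1.
apply/seteqP; split=> z /=; first by case=> -[].
by move=> ->; split; [right|exact: nesym].
Qed.

Theorem mainTheorem1 (R : realType) (m : nat) (m_gt0 : (0 < m)%N) :
  [/\ predecessors (sqrt2_map R) m = set0 <->
        (exists n : nat, (1 <= n)%N /\
          m = Num.truncn (n%:R * (2 + Num.sqrt 2) : R)),
      (predecessors (sqrt2_map R) m #= `I_1)%card <->
        (exists k : nat, (1 <= k)%N /\
          m = Num.truncn (2 * k%:R * Num.sqrt 2 : R))
    & (predecessors (sqrt2_map R) m #= `I_2)%card <->
        (exists k : nat, (1 <= k)%N /\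
          m = Num.truncn ((2 * k%:R - 1) * Num.sqrt 2 : R))].
Proof.
have evenE k : Num.truncn (2 * k%:R * Num.sqrt 2 : R) = floor_mul_sqrt2 R k.*2.
  by rewrite /floor_mul_sqrt2 -mul2n natrM.
have oddE k : (1 <= k)%N ->
    Num.truncn ((2 * k%:R - 1) * Num.sqrt 2 : R) = floor_mul_sqrt2 R k.*2.-1.
  case: k => // k _; rewrite /floor_mul_sqrt2 doubleS /=.
  congr (Num.truncn (_ * _)).
  by rewrite -(natr1 k) -(natr1 k.*2) -mul2n natrM; ring.
have even_card k : ~~ odd k ->
    (predecessors (sqrt2_map R) (floor_mul_sqrt2 R k) #= `I_1)%card.
  by move=> ek; rewrite predecessors_even_value ?card_set1.
have odd_card k : odd k ->
    (predecessors (sqrt2_map R) (floor_mul_sqrt2 R k) #= `I_2)%card.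
  (* An odd [k] is nonzero, hence [2k] and [k] are distinct. *)
  by move=> ok; rewrite predecessors_odd_value//; apply: card_set2; lia.
have value_of_card i : (0 < i)%N -> (predecessors (sqrt2_map R) m #= `I_i)%card ->
    exists2 k, (0 < k)%N & floor_mul_sqrt2 R k = m.
  (* The index is positive because [B 0 = 0 < m]; a non-value would have no predecessor, against
     [0 < i]. *)
  move=> i0 c; have [[k e]|/forallNP no] :=
    pselect (exists k, floor_mul_sqrt2 R k = m).
    exists k => //; rewrite lt0n; apply: contraTN m_gt0 => /eqP k0.
    by rewrite -e k0 /floor_mul_sqrt2 mul0r truncn0.
  move: c; rewrite predecessors_nonvalue// -II0 => /card_eq_II i_eq.
  by rewrite -i_eq in i0.
split.
- rewrite -(beatty_sqrt2 R _ m_gt0); split; last exact: predecessors_nonvalue.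
  (* Whatever the parity of [k], its double is a predecessor of [B k]. *)
  move=> no k e; have : predecessors (sqrt2_map R) m k.*2.
    by rewrite /predecessors /= sqrt2_map_double.
  by rewrite no.
- split=> [c|[k [_ ->]]]; last by rewrite evenE; apply: even_card; rewrite odd_double.
  have [k k0 e] := value_of_card 1%N isT c.
  (* An odd [k] would give two predecessors instead of one. *)
  have [ok|ek] := boolP (odd k).
    by move: c; rewrite -e => /(card_eq_I_unique _ _ _ _ (odd_card k ok)).
  by exists k./2; rewrite evenE even_halfK// e; split=> //; lia.
- split=> [c|[k [k1 ->]]]; last by rewrite oddE//; apply: odd_card; lia.
  have [k k0 e] := value_of_card 2%N isT c.
  have [ok|ek] := boolP (odd k); last first.
    by move: c; rewrite -e => /(card_eq_I_unique _ _ _ _ (even_card k ek)).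
  (* For odd [k], [k = 2 * (k./2 + 1) - 1]. *)
  exists k./2.+1; rewrite oddE//; split=> //; rewrite -e; congr floor_mul_sqrt2; lia.
Qed.
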